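(* Let $G$ be a commutative multiplicative hyperring with identity $1$, let $S$ be a multiplicative closed subset of $G$, and let $A_1,\ldots,A_k$ be quasi $S$-primary $\mathcal{C}$-hyperideals of $G$. If $\mathrm{rad}(A_i)=\mathrm{rad}(A_j)$ for all $i,j\in\{1,\ldots,k\}$, then $A=\bigcap_{i=1}^k A_i$ is a quasi $S$-primary hyperideal of $G$.
   Context: A commutative multiplicative hyperring with identity is a triple $(G,+,\circ)$ where $(G,+)$ is an abelian group and $\circ$ assigns to each pair $(x,y)\in G\times G$ a non-empty subset $x\circ y\subseteq G$, such that for all $x,y,z\in G$: $(x\circ y)\circ z=x\circ(y\circ z)$; $(-x)\circ y=x\circ(-y)=-(x\circ y)$; $(y+z)\circ x\subseteq y\circ x+z\circ x$ and $x\circ(y+z)\subseteq x\circ y+x\circ z$; $x\circ y=y\circ x$; and there is $1\in G$ with $a\in 1\circ a$ for all $a\in G$. For non-empty subsets $X,Y\subseteq G$, $X\circ Y=\bigcup_{x\in X,y\in Y}x\circ y$ and $X+Y=\{x+y: x\in X,y\in Y\}$; elements are identified with singletons. A hyperideal of $G$ is a non-empty $A\subseteq G$ with $x-y\in A$ for all $x,y\in A$ and $r\circ x\subseteq A$ for all $x\in A$, $r\in G$. A proper hyperideal $P$ is prime if $x\circ y\subseteq P$ ($x,y\in G$) implies $x\in P$ or $y\in P$. $\mathrm{rad}(A)$ is the intersection of all prime hyperideals containing $A$, and $\mathrm{rad}(A)=G$ if there are none. $A$ is a $\mathcal{C}$-hyperideal if for all $n\in\mathbb{N}$ and $a_1,\dots,a_n\in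 G$, $(a_1\circ\cdots\circ a_n)\cap A\neq\varnothing$ implies $a_1\circ\cdots\circ a_n\subseteq A$. A multiplicative closed subset (MCS) of $G$ is a subset $S\subseteq G$ containing $1$ with $(s_1\circ s_2)\cap S\neq\varnothing$ for all $s_1,s_2\in S$. A hyperideal $A$ with $A\cap S=\varnothing$ is quasi $S$-primary if there is $t\in S$ such that for all $u,v\in G$, $u\circ v\subseteq A$ implies $t\circ u\subseteq \mathrm{rad}(A)$ or $t\circ v\subseteq\mathrm{rad}(A)$. *)

(* Defs.v *)
From HB Require Import structures.
From mathcomp Require Import all_boot all_algebra.
From mathcomp Require Import boolp classical_sets.

Set Implicit Arguments.
Unset Strict Implicit.
Unset Printing Implicit Defensive.

Import GRing.Theory.

Local Open Scope classical_set_scope.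
Local Open Scope ring_scope.

Definition lift_hop (T : Type) (op : T -> T -> set T) (X Y : set T) : set T :=
  \bigcup_(x in X) \bigcup_(y in Y) op x y.

(* The identity [hone] is part of the structure: the axioms do not make it
   unique, and multiplicative closed subsets refer to a fixed one. *)
HB.mixin Record Zmodule_isComHyperring G of GRing.Zmodule G := {
  hmul : G -> G -> set G;
  hone : G;
  hmul_neq0 : forall x y, hmul x y !=set0;
  hmulA : forall x y z,
    lift_hop hmul (hmul x y) [set z] = lift_hop hmul [set x] (hmul y z);
  hmulNr_set : forall x y, hmul (- x) y = [set - z | z in hmul x y];
  hmulrN_set : forall x y, hmul x (- y) = [set - z | z in hmul x y];
  hmulDl_sub : forall x y z,
    hmul (y + z) x `<=` [set a + b | a in hmul y x & b in hmul z x];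
  hmulDr_sub : forall x y z,
    hmul x (y + z) `<=` [set a + b | a in hmul x y & b in hmul x z];
  hmulC : forall x y, hmul x y = hmul y x;
  hmul1_mem : forall a, hmul hone a a
}.

#[short(type="comHyperringType")]
HB.structure Definition ComHyperring :=
  { G of GRing.Zmodule G & Zmodule_isComHyperring G }.

Arguments hone {_}.

Section Hyperideals.
Variable G : comHyperringType.
Implicit Types (A P S X Y : set G).

Definition hmuls X Y : set G := lift_hop hmul X Y.

(* [hprod a s] is the product of the nonempty list [a :: s]; there is no empty
   product, since [set hone] need not be neutral for [hmuls]. *)
Definition hprod (a : G) (s : seq G) : set G :=
  foldl (fun X b => hmuls X [set b]) [set a] s.

Definition hyperideal A : Prop :=
  [/\ A !=set0,
      forall x y, A x -> A y -> A (x - y)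
    & forall r x, A x -> hmul r x `<=` A].

Definition prime_hyperideal P : Prop :=
  [/\ hyperideal P, P <> setT
    & forall x y, hmul x y `<=` P -> P x \/ P y].

(* An intersection over an empty family is [setT], so [hyperrad A] is the whole
   hyperring when no prime hyperideal contains [A]. *)
Definition hyperrad A : set G :=
  \bigcap_(P in [set P | prime_hyperideal P /\ A `<=` P]) P.

Definition C_hyperideal A : Prop :=
  hyperideal A /\
  forall (a : G) (s : seq G), hprod a s `&` A !=set0 -> hprod a s `<=` A.

Definition mult_closed S : Prop :=
  S hone /\ forall s1 s2, S s1 -> S s2 -> hmul s1 s2 `&` S !=set0.

Definition quasi_S_primary S A : Prop :=
  [/\ hyperideal A, A `&` S = set0
    & exists2 t, S t & forall u v, hmul u v `<=` A ->
        hmul t u `<=` hyperrad A \/ hmul t v `<=` hyperrad A].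

End Hyperideals.

(* Main.v *)
Require Import Defs.
From mathcomp Require Import all_boot all_algebra.
From mathcomp Require Import boolp classical_sets.

Local Open Scope classical_set_scope.

(** A prime hyperideal containing a finite intersection of hyperideals contains
    one of them ([prime_bigcap_sub]).  Hence the primes above [\bigcap_i A i]
    are exactly the primes above some [A i], and when all the radicals agree
    the intersection has that same radical ([hyperrad_bigcap]).

    With the radical unchanged, a witness [t] of the quasi primary property for
    any single [A i0] is also a witness for the intersection: a product
    [hmul u v] inside the intersection lies in [A i0], so that [hmul t u] or
    [hmul t v] lies in [hyperrad (A i0)], which is the radical of the
    intersection.  The intersection avoids [S] because [A i0] does. *)

Section HyperidealIntersections.
Context {G : comHyperringType}.
Implicit Types (B P : set G).

Lemma hyperideal0 B : hyperideal B -> B (0 : G)%R.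
Proof. by case=> -[x Bx] subB _; rewrite -(GRing.subrr x); apply: subB. Qed.

Lemma hyperideal_bigcap (I : Type) (D : set I) (A : I -> set G) :
  (forall i, D i -> hyperideal (A i)) -> hyperideal (\bigcap_(i in D) A i).
Proof.
move=> idA; split.
- by exists 0%R => i Di; apply: (hyperideal0 _ (idA i Di)).
- move=> x y Ax Ay i Di; have [_ subA _] := idA i Di.
  exact: subA x y (Ax i Di) (Ay i Di).
- move=> r x Ax y rxy i Di; have [_ _ mulA] := idA i Di.
  exact: mulA (Ax i Di) y rxy.
Qed.

Lemma hyperrad_sub B B' : B `<=` B' -> hyperrad B `<=` hyperrad B'.
Proof.
move=> BB' x radx P [pP B'P]; apply: radx.
by split=> //; apply: subset_trans B'P.
Qed.

(** Prime avoidance one ideal at a time: if [x] is outside [P] and lies in the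
    ideals treated so far, and [a] in the next ideal is also outside [P], then
    by primality some element of [hmul x a] is outside [P], and it lies in all
    these ideals by absorption. *)
Lemma prime_avoid_seq (I : eqType) (A : I -> set G) P (s : seq I) :
    prime_hyperideal P -> (forall i, hyperideal (A i)) ->
    (forall i, ~ A i `<=` P) ->
  exists2 x, ~ P x & forall i, i \in s -> A i x.
Proof.
move=> [_ PnT primeP] idA nAP; elim: s => [|j s [x nPx Ax]].
  have /existsNP[x /not_implyP[_ nPx]] : ~ [set: G] `<=` P by rewrite subTset.
  by exists x.
have /existsNP[a /not_implyP[Aa nPa]] := nAP j.
have /existsNP[y /not_implyP[xay nPy]] : ~ hmul x a `<=` P by case/primeP.
exists y => // i; rewrite inE => /predU1P[->|si].
  by have [_ _ mulA] := idA j; apply: (mulA x a Aa).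
by have [_ _ mulA] := idA i; apply: (mulA a x (Ax i si)); rewrite hmulC.
Qed.

Lemma prime_bigcap_sub (I : finType) (A : I -> set G) P :
    prime_hyperideal P -> (forall i, hyperideal (A i)) ->
    \bigcap_(i in [set: I]) A i `<=` P ->
  exists i, A i `<=` P.
Proof.
move=> pP idA capP; apply: contrapT => /forallNP nAP.
have [x nPx Ax] := prime_avoid_seq _ _ _ (enum I) pP idA nAP.
by apply/nPx/capP => i _; apply: Ax; rewrite mem_enum.
Qed.

Lemma hyperrad_bigcap (I : finType) (A : I -> set G) (i0 : I) :
    (forall i, hyperideal (A i)) ->
    (forall i, hyperrad (A i) = hyperrad (A i0)) ->
  hyperrad (\bigcap_(i in [set: I]) A i) = hyperrad (A i0).
Proof.
move=> idA radA; apply/seteqP; split.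
  by apply: hyperrad_sub => x; apply.
move=> x radx P [pP capP].
have [i AiP] := prime_bigcap_sub _ _ _ pP idA capP.
by move: radx; rewrite -(radA i); apply.
Qed.

End HyperidealIntersections.

Theorem proposition2p8 (G : comHyperringType) (S : set G) (hS : mult_closed S)
    (k : nat) (hk : (0 < k)%N) (A : 'I_k -> set G)
    (hqp : forall i : 'I_k, quasi_S_primary S (A i))
    (hC : forall i : 'I_k, C_hyperideal (A i))
    (hrad : forall i j : 'I_k, hyperrad (A i) = hyperrad (A j)) :
  quasi_S_primary S (\bigcap_(i in [set: 'I_k]) A i).
Proof.
pose i0 := Ordinal hk.
have idA i : hyperideal (A i) by case: (hqp i).
have [_ A0S [t St tP]] := hqp i0.
split.
- by apply: hyperideal_bigcap => i _; apply: idA.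
- rewrite -subset0 -A0S => x [Ax Sx]; split=> //; exact: Ax.
- exists t => // u v uvA; rewrite (hyperrad_bigcap _ A i0 idA) //.
  by apply: tP => x /uvA; apply.
Qed.
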